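(* Let $V$ be a finite-dimensional Hilbert space and $R\in\mathrm{End}(V\otimes V)$ a unitary Yang--Baxter operator with two distinct eigenvalues, normalized so that $(R+I)(R-qI)=0$ with $q\neq-1$. For every $n\ge2$ let $R_i$ ($1\le i<n$) be the local copies of $R$ on $V^{\otimes n}$, let $p_i=\frac{qI-R_i}{q+1}$, and let $\rho_n:H_n(q)\to\mathrm{End}(V^{\otimes n})$, $\rho_n(g_i)=R_i$, be the resulting Hecke representation. The following are equivalent. (i) For every $n\ge2$, the representation $\rho_n$ factors through the Temperley--Lieb quotient $\mathrm{TL}_n(q)$. (ii) On $V^{\otimes3}$, $p_1p_2p_1=\frac{q}{(1+q)^2}p_1$ and $p_2p_1p_2=\frac{q}{(1+q)^2}p_2$. (iii) For every $n\ge3$ and every $i,j\in\{1,\dots,n-1\}$ with $|i-j|=1$, $p_ip_jp_i=\frac{q}{(1+q)^2}p_i$.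
   Context: A unitary Yang--Baxter operator on $V$ is a unitary $R\in\mathrm{End}(V\otimes V)$ with $(R\otimes I)(I\otimes R)(R\otimes I)=(I\otimes R)(R\otimes I)(I\otimes R)$. Its local copies on $V^{\otimes n}$ are $R_i=I^{\otimes(i-1)}\otimes R\otimes I^{\otimes(n-i-1)}$. $H_n(q)$ is the Hecke algebra: the unital complex algebra with generators $g_1,\dots,g_{n-1}$ subject to the braid relations and $(g_i+1)(g_i-q)=0$. The Temperley--Lieb quotient $\mathrm{TL}_n(q)$ of $H_n(q)$ is obtained by imposing, for $e_i=\frac{q-g_i}{q+1}$, the relations $e_ie_je_i=\frac{q}{(1+q)^2}e_i$ for $|i-j|=1$. *)

(* Defs.v *)
From HB Require Import structures.
From mathcomp Require Import all_boot all_order all_algebra.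
From mathcomp Require Import ring_quotient generic_quotient.
From mathcomp Require Import boolp reals complex mxtens.
From mathcomp Require Import finmap monalg zify.

Set Implicit Arguments.
Unset Strict Implicit.
Unset Printing Implicit Defensive.

Import GRing.Theory Num.Theory.

Local Open Scope quotient_scope.
Local Open Scope ring_scope.

Section AlgebraQuotient.
Variables (F : fieldType) (A : algType F).

Inductive ideal_gen (S : A -> Prop) : A -> Prop :=
| IdealGen x of S x : ideal_gen S x
| IdealGen0 : ideal_gen S 0
| IdealGenB x y of ideal_gen S x & ideal_gen S y : ideal_gen S (x - y)
| IdealGenMl a x of ideal_gen S x : ideal_gen S (a * x)
| IdealGenMr a x of ideal_gen S x : ideal_gen S (x * a).

(* Properness is recorded because an [algType] satisfies 1 != 0. *)
Record relators := Relators {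
  relator :> A -> Prop;
  relator_proper : ~ ideal_gen relator 1 }.

Variable S : relators.

Definition rel_ideal : {pred A} := fun x => `[< ideal_gen S x >].

Lemma rel_idealP x : reflect (ideal_gen S x) (x \in rel_ideal).
Proof. exact: asboolP. Qed.

Fact rel_ideal_zmod : zmod_closed rel_ideal.
Proof.
split=> [|x y /rel_idealP Sx /rel_idealP Sy]; apply/rel_idealP.
  exact: IdealGen0.
exact: IdealGenB.
Qed.
HB.instance Definition _ := GRing.isZmodClosed.Build A rel_ideal rel_ideal_zmod.

Lemma rel_idealMl a x : x \in rel_ideal -> a * x \in rel_ideal.
Proof. by move=> /rel_idealP Sx; apply/rel_idealP/IdealGenMl. Qed.

Lemma rel_idealMr a x : x \in rel_ideal -> x * a \in rel_ideal.
Proof. by move=> /rel_idealP Sx; apply/rel_idealP/IdealGenMr. Qed.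

Lemma rel_idealZ (c : F) x : x \in rel_ideal -> c *: x \in rel_ideal.
Proof. by move=> Ix; rewrite -[x]mul1r scalerAl rel_idealMl. Qed.

Definition alg_quot : Type := Quotient.quot rel_ideal.
HB.instance Definition _ := GRing.Zmodule.on alg_quot.

Definition quot_proj (x : A) : alg_quot := \pi_(Quotient.quot rel_ideal) x.

Lemma quot_proj_eq x y : (quot_proj x = quot_proj y) = (x - y \in rel_ideal).
Proof. by rewrite Quotient.idealrBE; apply/propext; split=> /eqP. Qed.

Definition quot_repr (u : alg_quot) : A := repr (u : Quotient.quot rel_ideal).

Lemma quot_reprK : cancel quot_repr quot_proj.
Proof. by move=> u; exact: reprK. Qed.

Fact quot_proj_is_zmod : zmod_morphism quot_proj.
Proof. by move=> x y; rewrite /quot_proj raddfB. Qed.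
HB.instance Definition _ :=
  GRing.isZmodMorphism.Build A alg_quot quot_proj quot_proj_is_zmod.

Fact quot_key : unit. Proof. by []. Qed.
Let one : alg_quot := quot_proj 1.
Let mul : alg_quot -> alg_quot -> alg_quot := locked_with quot_key
  (fun u v => quot_proj (quot_repr u * quot_repr v)).
Let scale : F -> alg_quot -> alg_quot := locked_with quot_key
  (fun c u => quot_proj (c *: quot_repr u)).

Let repr_proj x : quot_repr (quot_proj x) - x \in rel_ideal.
Proof. by rewrite -quot_proj_eq quot_reprK. Qed.

Let projM x y : mul (quot_proj x) (quot_proj y) = quot_proj (x * y).
Proof.
rewrite /mul unlock quot_proj_eq.
set x' := quot_repr _; set y' := quot_repr _.
have -> : x' * y' - x * y = (x' - x) * y' + x * (y' - y).
  by rewrite mulrBl mulrBr addrA subrK.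
by apply: rpredD; [apply: rel_idealMr | apply: rel_idealMl]; apply: repr_proj.
Qed.

Let projZ c x : scale c (quot_proj x) = quot_proj (c *: x).
Proof. by rewrite /scale unlock quot_proj_eq -scalerBr rel_idealZ ?repr_proj. Qed.

Let quotW (P : alg_quot -> Prop) :
  (forall x, P (quot_proj x)) -> forall u, P u.
Proof. by move=> Pp u; rewrite -[u]quot_reprK. Qed.

Fact quot_mulA : associative mul.
Proof.
elim/quotW=> x; elim/quotW=> y; elim/quotW=> z.
by rewrite !projM mulrA.
Qed.
Fact quot_mul1 : left_id one mul.
Proof. by elim/quotW=> x; rewrite projM mul1r. Qed.
Fact quot_mulr1 : right_id one mul.
Proof. by elim/quotW=> x; rewrite projM mulr1. Qed.
Fact quot_mulDl : left_distributive mul +%R.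
Proof.
elim/quotW=> x; elim/quotW=> y; elim/quotW=> z.
by rewrite -raddfD !projM -raddfD mulrDl.
Qed.
Fact quot_mulDr : right_distributive mul +%R.
Proof.
elim/quotW=> x; elim/quotW=> y; elim/quotW=> z.
by rewrite -raddfD !projM -raddfD mulrDr.
Qed.
Fact quot_nz : one != 0.
Proof.
apply/eqP; rewrite -(raddf0 quot_proj) quot_proj_eq.
by rewrite subr0 => /rel_idealP; apply: relator_proper.
Qed.
HB.instance Definition _ := GRing.Zmodule_isNzRing.Build alg_quot
  quot_mulA quot_mul1 quot_mulr1 quot_mulDl quot_mulDr quot_nz.

Fact quot_scaleA a b u : scale a (scale b u) = scale (a * b) u.
Proof. by elim/quotW: u => x; rewrite !projZ scalerA. Qed.
Fact quot_scale1 : left_id 1 scale.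
Proof. by elim/quotW=> x; rewrite projZ scale1r. Qed.
Fact quot_scaleDr : right_distributive scale +%R.
Proof.
move=> a; elim/quotW=> x; elim/quotW=> y.
by rewrite -raddfD !projZ -raddfD scalerDr.
Qed.
Fact quot_scaleDl u : {morph scale^~ u : a b / a + b}.
Proof. by elim/quotW: u => x a b; rewrite !projZ -raddfD scalerDl. Qed.
HB.instance Definition _ := GRing.Zmodule_isLmodule.Build F alg_quot
  quot_scaleA quot_scale1 quot_scaleDr quot_scaleDl.

Lemma quot_projM x y : quot_proj x * quot_proj y = quot_proj (x * y).
Proof. exact: projM. Qed.

Lemma quot_projZ c x : c *: quot_proj x = quot_proj (c *: x).
Proof. exact: projZ. Qed.

Fact quot_scaleAl (c : F) (u v : alg_quot) : c *: (u * v) = (c *: u) * v.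
Proof.
elim/quotW: u => x; elim/quotW: v => y.
by rewrite !(quot_projZ, quot_projM) scalerAl.
Qed.
HB.instance Definition _ := GRing.Lmodule_isLalgebra.Build F alg_quot
  quot_scaleAl.

Fact quot_scaleAr (c : F) (u v : alg_quot) : c *: (u * v) = u * (c *: v).
Proof.
elim/quotW: u => x; elim/quotW: v => y.
by rewrite !(quot_projZ, quot_projM) scalerAr.
Qed.
HB.instance Definition _ := GRing.Lalgebra_isAlgebra.Build F alg_quot
  quot_scaleAr.

Fact quot_proj_is_monoid : monoid_morphism quot_proj.
Proof. by split=> // x y; rewrite quot_projM. Qed.
HB.instance Definition _ :=
  GRing.isMonoidMorphism.Build A alg_quot quot_proj quot_proj_is_monoid.

Fact quot_proj_is_scalable : scalable quot_proj.
Proof. by move=> c x; rewrite quot_projZ. Qed.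
HB.instance Definition _ :=
  GRing.isScalable.Build F A alg_quot *:%R quot_proj quot_proj_is_scalable.

Lemma quot_proj_relator x : S x -> quot_proj x = 0.
Proof.
move=> Sx; rewrite -(raddf0 quot_proj); rewrite quot_proj_eq.
by rewrite subr0; apply/rel_idealP/IdealGen.
Qed.
End AlgebraQuotient.

Lemma ideal_gen_ker (F : fieldType) (A : algType F) (S : A -> Prop)
    (B : pzRingType) (f : {rmorphism A -> B}) :
  (forall x, S x -> f x = 0) -> forall x, ideal_gen S x -> f x = 0.
Proof.
move=> fS x; elim=> {x} [x /fS //||x y _ fx _ fy|a x _ fx|a x _ fx].
- exact: rmorph0.
- by rewrite rmorphB fx fy subr0.
- by rewrite rmorphM fx mulr0.
- by rewrite rmorphM fx mul0r.
Qed.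

Lemma ideal_gen_proper (F : fieldType) (A : algType F) (S : A -> Prop)
    (B : nzRingType) (f : {rmorphism A -> B}) :
  (forall x, S x -> f x = 0) -> ~ ideal_gen S 1.
Proof.
by move=> fS /(ideal_gen_ker fS); rewrite rmorph1 => /eqP; rewrite oner_eq0.
Qed.

Section QuotientLift.
Variables (F : fieldType) (A : algType F) (S : relators A).
Variables (B : pzRingType) (s : F -> B -> B) (f : {lrmorphism A -> B | s}).
Hypothesis fS : forall x, S x -> f x = 0.

Definition quot_lift of (forall x, S x -> f x = 0) :=
  fun u : alg_quot S => f (quot_repr u).
Local Notation lift := (quot_lift fS).

Lemma quot_liftE x : lift (quot_proj S x) = f x.
Proof.
have : quot_repr (quot_proj S x) - x \in rel_ideal S.
  by rewrite -quot_proj_eq quot_reprK.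
move=> /rel_idealP/(ideal_gen_ker fS) /eqP.
by rewrite raddfB subr_eq0 => /eqP.
Qed.

Fact quot_lift_is_zmod : zmod_morphism lift.
Proof.
move=> u v; rewrite -[u]quot_reprK -[v]quot_reprK -raddfB !quot_liftE.
exact: raddfB.
Qed.
HB.instance Definition _ :=
  GRing.isZmodMorphism.Build (alg_quot S) B lift quot_lift_is_zmod.

Fact quot_lift_is_monoid : monoid_morphism lift.
Proof.
split=> [|u v]; first by rewrite -(rmorph1 (quot_proj S)) quot_liftE rmorph1.
rewrite -[u]quot_reprK -[v]quot_reprK -rmorphM !quot_liftE.
exact: rmorphM.
Qed.
HB.instance Definition _ :=
  GRing.isMonoidMorphism.Build (alg_quot S) B lift quot_lift_is_monoid.

Fact quot_lift_is_scalable : scalable_for s lift.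
Proof. by move=> c u; rewrite -[u]quot_reprK quot_projZ !quot_liftE linearZ_LR. Qed.
HB.instance Definition _ :=
  GRing.isScalable.Build F (alg_quot S) B s lift quot_lift_is_scalable.
End QuotientLift.

Section FreeAlgebra.
Variables (F : fieldType) (m : nat).

Definition free_alg : Type := {malg F[{fmonom 'I_m}]}.
HB.instance Definition _ := GRing.Lalgebra.on free_alg.

Fact free_alg_scaleAr (c : F) (x y : free_alg) : c *: (x * y) = x * (c *: y).
Proof.
have cC (z : {malg F[{fmonom 'I_m}]}) : z * c%:MP = c *: z.
  rewrite (malgMEw (fsubset_refl _) (msuppC_le c)).
  rewrite -mul_malgC (malgMEw (msuppC_le c) (fsubset_refl _)) big_seq_fset1.
  apply: eq_bigr => w _; rewrite big_seq_fset1.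
  by rewrite mulm1 mul1m mulrC.
rewrite scalerAl -[in LHS]cC -[in RHS]mul_malgC.
exact/esym/(@mulrA {malg F[{fmonom 'I_m}]}).
Qed.
HB.instance Definition _ :=
  GRing.Lalgebra_isAlgebra.Build F free_alg free_alg_scaleAr.

Fact free_key : unit. Proof. by []. Qed.
Definition free_gen (i : 'I_m) : free_alg := locked_with free_key << fmu i >>.

Section Eval.
Variables (k : nat) (x : 'I_m -> 'M[F]_k).

Definition word_eval (w : {fmonom 'I_m}) : 'M[F]_k := \prod_(i <- w) x i.

Definition free_eval (p : free_alg) : 'M[F]_k :=
  \sum_(w <- msupp p) p@_w *: word_eval w.

Lemma free_evalEw (D : {fset {fmonom 'I_m}}) (p : free_alg) :
  (msupp p `<=` D)%fset -> free_eval p = \sum_(w <- D) p@_w *: word_eval w.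
Proof.
move=> le; rewrite [LHS](big_fset_incl _ le) => //= w wD /mcoeff_outdom ->.
by rewrite scale0r.
Qed.

Lemma free_evalU (c : F) w : free_eval << c *g w >> = c *: word_eval w.
Proof. by rewrite (free_evalEw msuppU_le) big_seq_fset1 mcoeffUU. Qed.

Lemma free_eval_gen i : free_eval (free_gen i) = x i.
Proof.
by rewrite /free_gen unlock free_evalU scale1r /word_eval fmU big_seq1.
Qed.

Fact free_eval_is_zmod : zmod_morphism free_eval.
Proof.
move=> p r; pose D := (msupp p `|` msupp r `|` msupp (p - r))%fset.
have [pD rD prD] : [/\ (msupp p `<=` D)%fset, (msupp r `<=` D)%fset
    & (msupp (p - r)%R `<=` D)%fset].
  split; apply/fsubsetP => w; rewrite !in_fsetU => ->; by rewrite ?orbT.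
rewrite (free_evalEw pD) (free_evalEw rD) (free_evalEw prD) -sumrB.
by apply: eq_bigr => w _; rewrite mcoeffB scalerBl.
Qed.
HB.instance Definition _ :=
  GRing.isZmodMorphism.Build free_alg 'M[F]_k free_eval free_eval_is_zmod.

Lemma word_evalM (v w : {fmonom 'I_m}) :
  word_eval (mmul v w) = word_eval v *m word_eval w.
Proof. by rewrite /word_eval fmM big_cat. Qed.

Fact free_eval_is_monoid : monoid_morphism free_eval.
Proof.
split=> [|p r].
  by rewrite free_evalU scale1r /word_eval fm1 big_nil.
rewrite [p * r]malgME raddf_sum [RHS]mulmx_suml /=; apply: eq_bigr => v _.
rewrite raddf_sum mulmx_sumr /=; apply: eq_bigr => w _.
by rewrite free_evalU word_evalM -scalemxAl -scalemxAr scalerA.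
Qed.
HB.instance Definition _ :=
  GRing.isMonoidMorphism.Build free_alg 'M[F]_k free_eval free_eval_is_monoid.

Fact free_eval_is_scalable : scalable free_eval.
Proof.
move=> c p; rewrite (free_evalEw (msuppZ_le _ _)) scaler_sumr.
by apply: eq_bigr => w _; rewrite mcoeffZ scalerA.
Qed.
HB.instance Definition _ :=
  GRing.isScalable.Build F free_alg 'M[F]_k *:%R free_eval
    free_eval_is_scalable.
End Eval.
End FreeAlgebra.

Lemma lrmorph_scalar_mx (F : fieldType) (A : algType F) k
  (f : {lrmorphism A -> 'M[F]_k}) (c : F) : f c%:A = c%:M.
Proof. by rewrite linearZ /= rmorph1; apply: scalemx1. Qed.

Lemma lrmorph_braid0 (F : fieldType) (A : algType F) k
    (f : {lrmorphism A -> 'M[F]_k}) (a b : A) :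
  f a *m f b *m f a = f b *m f a *m f b -> f (a * b * a - b * a * b) = 0.
Proof. by move=> fab; apply/eqP; rewrite rmorphB !rmorphM subr_eq0; apply/eqP. Qed.

Lemma lrmorph_comm0 (F : fieldType) (A : algType F) k
    (f : {lrmorphism A -> 'M[F]_k}) (a b : A) :
  f a *m f b = f b *m f a -> f (a * b - b * a) = 0.
Proof. by move=> fab; apply/eqP; rewrite rmorphB !rmorphM subr_eq0; apply/eqP. Qed.

Lemma lrmorph_quadratic0 (F : fieldType) (A : algType F) k
    (f : {lrmorphism A -> 'M[F]_k}) (a : A) (q : F) :
  (f a + 1%:M) *m (f a - q%:M) = 0 -> f ((a + 1) * (a - q%:A)) = 0.
Proof.
have fq : f q%:A = q%:M by exact: lrmorph_scalar_mx.
by move=> fa; rewrite rmorphM rmorphD rmorphB rmorph1 /= fq.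
Qed.

Lemma lrmorph_idempotent (F : fieldType) (A : algType F) k
    (f : {lrmorphism A -> 'M[F]_k}) (c q : F) (a : A) :
  f (c *: (q%:A - a)) = c *: (q%:M - f a).
Proof.
have fq : f q%:A = q%:M by exact: lrmorph_scalar_mx.
by rewrite linearZ linearB /= fq.
Qed.

Lemma lrmorph_tl (F : fieldType) (A : algType F) k
    (f : {lrmorphism A -> 'M[F]_k}) (c : F) (a b : A) :
  f (a * b * a - c *: a) = f a *m f b *m f a - c *: f a.
Proof. by rewrite rmorphB !rmorphM /= linearZ. Qed.

Section Hecke.
Variables (F : fieldType) (n : nat) (q : F).

(* The index i : 'I_n.-1 stands for the generator g_(i+1), 1 <= i+1 < n. *)
Local Notation g := (@free_gen F n.-1).

Inductive hecke_relator : free_alg F n.-1 -> Prop :=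
| HeckeQuadratic i : hecke_relator ((g i + 1) * (g i - q%:A))
| HeckeBraid (i j : 'I_n.-1) of `|i - j|%N = 1%N :
    hecke_relator (g i * g j * g i - g j * g i * g j)
| HeckeComm (i j : 'I_n.-1) of (1 < `|i - j|)%N : hecke_relator (g i * g j - g j * g i).

Lemma free_eval_hecke k (x : 'I_n.-1 -> 'M[F]_k) :
    (forall i, (x i + 1%:M) *m (x i - q%:M) = 0) ->
    (forall i j : 'I_n.-1, `|i - j|%N = 1%N ->
       x i *m x j *m x i = x j *m x i *m x j) ->
    (forall i j : 'I_n.-1, (1 < `|i - j|)%N -> x i *m x j = x j *m x i) ->
  forall p, hecke_relator p -> free_eval x p = 0.
Proof.
move=> xq xb xc _ [i|i j ij|i j ij].
- by apply: lrmorph_quadratic0; rewrite /= free_eval_gen.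
- by apply: lrmorph_braid0; rewrite /= !free_eval_gen; apply: xb.
- by apply: lrmorph_comm0; rewrite /= !free_eval_gen; apply: xc.
Qed.

(* g_i |-> a is a character of the Hecke algebra for a = -1 and a = q; it
   witnesses 1 != 0 in the Hecke and Temperley-Lieb algebras. *)
Fact character_hecke (a : F) : (a + 1) * (a - q) = 0 ->
  forall p, hecke_relator p ->
  free_eval (fun=> a%:M : 'M[F]_1) p = 0.
Proof.
move=> aq; apply: free_eval_hecke => // i.
by rewrite -raddfD -raddfB -scalar_mxM aq raddf0.
Qed.

Fact hecke_relator_proper : ~ ideal_gen hecke_relator 1.
Proof.
apply: (@ideal_gen_proper _ _ _ _ (free_eval (fun=> (-1)%:M : 'M[F]_1))).
by apply: character_hecke; rewrite addNr mul0r.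
Qed.

Definition hecke_relators := Relators hecke_relator_proper.

Definition hecke : Type := alg_quot hecke_relators.
HB.instance Definition _ := GRing.Algebra.on hecke.

Definition hecke_gen (i : 'I_n.-1) : hecke := quot_proj hecke_relators (g i).

Section Representation.
Variables (k : nat) (x : 'I_n.-1 -> 'M[F]_k).
Hypothesis xH : forall p, hecke_relator p -> free_eval x p = 0.

Definition hecke_lift : {lrmorphism hecke -> 'M[F]_k} :=
  @quot_lift _ _ hecke_relators _ _ (free_eval x) xH.

Lemma hecke_lift_gen i : hecke_lift (hecke_gen i) = x i.
Proof. by rewrite [LHS]quot_liftE; apply: free_eval_gen. Qed.
End Representation.

(* Meaningful for q != -1 only: (q + 1)^-1 = 0 when q = -1. *)
Definition hecke_e (i : 'I_n.-1) : hecke :=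
  (q + 1)^-1 *: (q%:A - hecke_gen i).

Inductive tl_relator : hecke -> Prop :=
| TLRelator (i j : 'I_n.-1) of `|i - j|%N = 1%N :
    tl_relator (hecke_e i * hecke_e j * hecke_e i
                - (q / (1 + q) ^+ 2) *: hecke_e i).

Fact tl_relator_proper : ~ ideal_gen tl_relator 1.
Proof.
have xH : forall p, hecke_relator p ->
    free_eval (fun=> q%:M : 'M[F]_1) p = 0.
  by apply: character_hecke; rewrite subrr mulr0.
have e0 i : hecke_lift xH (hecke_e i) = 0.
  by rewrite lrmorph_idempotent hecke_lift_gen subrr scaler0.
apply: (@ideal_gen_proper _ _ _ _ (hecke_lift xH)) => _ [i j _].
by apply: etrans (lrmorph_tl (hecke_lift xH) _ _ _) _; rewrite !e0 mulmx0 scaler0 subr0.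
Qed.

Definition tl_relators := Relators tl_relator_proper.

Definition temperley_lieb : Type := alg_quot tl_relators.
HB.instance Definition _ := GRing.Algebra.on temperley_lieb.

Definition tl_proj : {lrmorphism hecke -> temperley_lieb} :=
  quot_proj tl_relators.
End Hecke.

Lemma tensmxA (F : fieldType) m n p (A : 'M[F]_m) (B : 'M[F]_n) (C : 'M[F]_p) :
  castmx (mulnA m n p, mulnA m n p) (A *t (B *t C)) = A *t B *t C.
Proof.
apply/matrixP => i j; rewrite castmxE.
case: (mxtens_indexP i) => i12 i3; case: (mxtens_indexP i12) => i1 i2.
case: (mxtens_indexP j) => j12 j3; case: (mxtens_indexP j12) => j1 j2.
rewrite !tensmxE.
have E (a : 'I_m) (b : 'I_n) (c : 'I_p) :
    cast_ord (esym (mulnA m n p)) (mxtens_index (mxtens_index (a, b), c))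
    = mxtens_index (a, mxtens_index (b, c)).
  by apply: val_inj; rewrite /= mulnDl mulnA addnA.
by rewrite !E !tensmxE mulrA.
Qed.

Lemma tensmx11 (F : fieldType) m n :
  (1%:M : 'M[F]_m) *t (1%:M : 'M[F]_n) = 1%:M.
Proof.
apply/matrixP => i j.
case: (mxtens_indexP i) => i1 i2; case: (mxtens_indexP j) => j1 j2.
rewrite tensmxE !mxE (can_eq (@mxtens_indexK _ _)) xpair_eqE.
by rewrite -natrM mulnb.
Qed.

(* Square matrices of all sizes together, where *t is strictly associative. *)
Section SizedMatrices.
Variable F : fieldType.

Definition smx (m : nat) (A : 'M[F]_m) : {m : nat & 'M[F]_m} := Tagged _ A.
Definition smx_tens (u v : {m : nat & 'M[F]_m}) :=
  smx (tagged u *t tagged v).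
Definition smx1 (m : nat) := smx (1%:M : 'M[F]_m).

Lemma smx_cast m p (e : m = p) (A : 'M[F]_m) : smx (castmx (e, e) A) = smx A.
Proof. by case: p / e; rewrite castmx_id. Qed.

Lemma smx_castP m p (e : p = m) (A : 'M[F]_m) (B : 'M[F]_p) :
  smx A = smx B -> A = castmx (e, e) B.
Proof.
case: m / e A => A; rewrite castmx_id.
by move=> /(congr1 (tagged_as (smx A))); rewrite !tagged_asE.
Qed.

Lemma smxT m p (A : 'M[F]_m) (B : 'M[F]_p) :
  smx (A *t B) = smx_tens (smx A) (smx B).
Proof. by []. Qed.

Lemma smx_tensA : associative smx_tens.
Proof.
move=> [m A] [n B] [p C]; rewrite /smx_tens /= -tensmxA.
by rewrite smx_cast.
Qed.

Lemma smx_tens11 m n : smx_tens (smx1 m) (smx1 n) = smx1 (m * n).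
Proof. by rewrite /smx1 -smxT tensmx11. Qed.
End SizedMatrices.

Section LocalCopies.
Variables (F : fieldType) (d : nat).

Fact local_dim n (i : 'I_n.-1) : (d ^ i * (d * d) * d ^ (n - i - 2) = d ^ n)%N.
Proof.
rewrite mulnn -!expnD; congr (d ^ _)%N.
by case: n i => [|[|n]] [i /= lt_i] //; lia.
Qed.

(* The index i : 'I_n.-1 stands for R_(i+1), which acts on the tensor factors
   i+1 and i+2; End(V^{(x) n}) is 'M_(d ^ n) in the basis of pure tensors. *)
Definition local_copy n (R : 'M[F]_(d * d)) (i : 'I_n.-1) : 'M[F]_(d ^ n) :=
  castmx (local_dim i, local_dim i)
    ((1%:M : 'M_(d ^ i)) *t R *t (1%:M : 'M_(d ^ (n - i - 2)))).

Definition yang_baxter (R : 'M[F]_(d * d)) : Prop :=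
  let R1 := R *t (1%:M : 'M_d) in
  let R2 := castmx (mulnA d d d, mulnA d d d) ((1%:M : 'M_d) *t R) in
  R1 *m R2 *m R1 = R2 *m R1 *m R2.

Lemma local_copyM n (A B : 'M[F]_(d * d)) (i : 'I_n.-1) :
  local_copy (A *m B) i = local_copy A i *m local_copy B i.
Proof.
rewrite /local_copy; case: _ / (local_dim i); rewrite !castmx_id.
by rewrite !tensmx_mul !mulmx1.
Qed.

Fact local_copy_is_linear n (i : 'I_n.-1) :
  linear (fun R : 'M[F]_(d * d) => local_copy R i).
Proof.
move=> c A B; rewrite /local_copy; case: _ / (local_dim i).
rewrite !castmx_id; apply/matrixP => x y; rewrite !mxE.
by rewrite mulrDr mulrDl mulrCA !mulrA.
Qed.

Lemma local_copyD n A B (i : 'I_n.-1) :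
  local_copy (A + B) i = local_copy A i + local_copy B i.
Proof. by have := local_copy_is_linear i 1 A B; rewrite !scale1r. Qed.

Lemma local_copyB n A B (i : 'I_n.-1) :
  local_copy (A - B) i = local_copy A i - local_copy B i.
Proof.
by have := local_copy_is_linear i (-1) B A; rewrite !scaleN1r !(addrC (- _)).
Qed.

Lemma local_copy0 n (i : 'I_n.-1) : local_copy 0 i = 0.
Proof. by rewrite -[X in local_copy X](subrr 0) local_copyB subrr. Qed.

Lemma local_copy_scalar n c (i : 'I_n.-1) :
  local_copy (c%:M : 'M[F]_(d * d)) i = c%:M.
Proof.
rewrite -scalemx1 -[c *: _]addr0 local_copy_is_linear local_copy0 addr0.
rewrite -[RHS]scalemx1; congr (_ *: _); rewrite /local_copy.
by case: _ / (local_dim i); rewrite castmx_id !tensmx11.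
Qed.

Lemma local_copy_adjacent n (i j : 'I_n.-1) (R : 'M[F]_(d * d)) :
  i.+1 = j :> nat ->
  exists (e : (d ^ i * (d * d * d) * d ^ (n - i - 3) = d ^ n)%N),
    local_copy R i = castmx (e, e)
      ((1%:M : 'M_(d ^ i)) *t (R *t (1%:M : 'M_d))
         *t (1%:M : 'M_(d ^ (n - i - 3)))) /\
    local_copy R j = castmx (e, e)
      ((1%:M : 'M_(d ^ i)) *t
         castmx (mulnA d d d, mulnA d d d) ((1%:M : 'M_d) *t R)
         *t (1%:M : 'M_(d ^ (n - i - 3)))).
Proof.
move=> ij; have lt_j : (j < n.-1)%N by [].
have e : (d ^ i * (d * d * d) * d ^ (n - i - 3) = d ^ n)%N.
  rewrite (_ : d * d * d = d ^ 3)%N; last by rewrite !expnS expn0 muln1 mulnA.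
  by rewrite -!expnD; congr (d ^ _)%N; lia.
exists e; split; apply: smx_castP.
  rewrite smx_cast !smxT -!smx_tensA -!/(smx1 _ _) smx_tens11 -expnS.
  by do 2!congr smx_tens; congr (smx1 _ (d ^ _)); lia.
rewrite smx_cast !smxT smx_cast smxT !smx_tensA -!/(smx1 _ _) smx_tens11.
rewrite -expnSr ij; congr smx_tens.
by congr (smx1 _ (d ^ _)); lia.
Qed.

Lemma local_copy_braid n (i j : 'I_n.-1) (R : 'M[F]_(d * d)) :
  yang_baxter R -> `|i - j|%N = 1%N ->
  local_copy R i *m local_copy R j *m local_copy R i =
  local_copy R j *m local_copy R i *m local_copy R j.
Proof.
move=> yb.
wlog ij : i j / i.+1 = j :> nat.
  move=> th dij; have [|] : i.+1 = j :> nat \/ j.+1 = i :> nat by lia.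
    by move=> /th; apply.
  by move=> ji; apply/esym/th => //; lia.
move=> _; have [e [-> ->]] := local_copy_adjacent R ij.
case: _ / e; rewrite !castmx_id !tensmx_mul !mulmx1.
by rewrite yb.
Qed.

Lemma local_copy_comm n (i j : 'I_n.-1) (R : 'M[F]_(d * d)) :
  (1 < `|i - j|)%N ->
  local_copy R i *m local_copy R j = local_copy R j *m local_copy R i.
Proof.
wlog ij : i j / (i.+1 < j)%N.
  move=> th dij; have [|] : (i.+1 < j)%N \/ (j.+1 < i)%N by lia.
    by move=> /th; apply.
  by move=> ji; apply/esym/th => //; lia.
move=> _; have lt_j : (j < n.-1)%N by [].
pose b := (d ^ (j - i - 2))%N; pose c := (d ^ (n - j - 2))%N.
have e : (d ^ i * (d * d) * b * (d * d) * c = d ^ n)%N.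
  by rewrite mulnn -!expnD; congr (d ^ _)%N; lia.
have -> : local_copy R i = castmx (e, e)
    ((1%:M : 'M_(d ^ i)) *t R *t (1%:M : 'M_b) *t (1%:M : 'M_(d * d))
       *t (1%:M : 'M_c)).
  apply: smx_castP; rewrite smx_cast !smxT -!smx_tensA -!/(smx1 _ _).
  rewrite !smx_tens11; do 2!congr smx_tens; congr (smx1 _ _).
  by rewrite mulnn -!expnD; congr (d ^ _)%N; lia.
have -> : local_copy R j = castmx (e, e)
    ((1%:M : 'M_(d ^ i)) *t (1%:M : 'M_(d * d)) *t (1%:M : 'M_b) *t R
       *t (1%:M : 'M_c)).
  apply: smx_castP; rewrite smx_cast !smxT -!/(smx1 _ _).
  rewrite !smx_tens11; do 2!congr smx_tens; congr (smx1 _ _).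
  by rewrite mulnn -!expnD; congr (d ^ _)%N; lia.
by case: _ / e; rewrite !castmx_id !tensmx_mul !mulmx1 !mul1mx.
Qed.

Definition local_idempotent n (R : 'M[F]_(d * d)) (q : F) (i : 'I_n.-1) :
    'M[F]_(d ^ n) :=
  (q + 1)^-1 *: (q%:M - local_copy R i).

Section HeckeRepresentation.
Variables (R : 'M[F]_(d * d)) (q : F).
Hypothesis ybR : yang_baxter R.
Hypothesis quadR : (R + 1%:M) *m (R - q%:M) = 0.

Fact hecke_rep_relator n p :
  @hecke_relator F n q p -> free_eval (@local_copy n R) p = 0.
Proof.
apply: free_eval_hecke => [i|i j|i j].
- rewrite -(local_copy_scalar 1 i) -(local_copy_scalar q i).
  by rewrite -local_copyD -local_copyB -local_copyM quadR local_copy0.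
- exact: local_copy_braid.
- exact: local_copy_comm.
Qed.

Definition hecke_rep n : {lrmorphism hecke n q -> 'M[F]_(d ^ n)} :=
  hecke_lift (@hecke_rep_relator n).

Lemma hecke_rep_gen n (i : 'I_n.-1) :
  hecke_rep n (hecke_gen q i) = local_copy R i.
Proof. exact: hecke_lift_gen. Qed.
End HeckeRepresentation.
End LocalCopies.

(* Main.v *)
(* A Temperley-Lieb relation between two adjacent local copies on V^{(x) n} is
   the image, under the algebra map X |-> I (x) X (x) I, of a relation between
   P (x) I and I (x) P on V^{(x) 3}.  For n = 3 this map is injective, since the
   identities act on one-dimensional spaces, so the relations for n = 3 imply
   those for all n.  The relations for all n say exactly that rho_n kills the
   relators of TL_n(q), that is, that it factors through the quotient. *)
Require Import Defs.
From mathcomp Require Import all_boot all_order all_algebra.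
From mathcomp Require Import reals complex mxtens zify.

Set Implicit Arguments.
Unset Strict Implicit.
Unset Printing Implicit Defensive.

Import GRing.Theory Num.Theory.

Local Open Scope ring_scope.

Section Ampliation.
Variables (F : fieldType) (a b m N : nat) (e : (a * m * b = N)%N).

Definition ampliation (X : 'M[F]_m) : 'M[F]_N :=
  castmx (e, e) ((1%:M : 'M_a) *t X *t (1%:M : 'M_b)).

Lemma ampliationM X Y : ampliation (X *m Y) = ampliation X *m ampliation Y.
Proof.
by rewrite /ampliation; case: _ / e; rewrite !castmx_id !tensmx_mul !mulmx1.
Qed.

Lemma ampliationZ c X : ampliation (c *: X) = c *: ampliation X.
Proof.
rewrite /ampliation; case: _ / e; rewrite !castmx_id.
by apply/matrixP => i j; rewrite !mxE mulrCA !mulrA.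
Qed.

Lemma ampliation_tl c X Y : X *m Y *m X = c *: X ->
  ampliation X *m ampliation Y *m ampliation X = c *: ampliation X.
Proof. by move=> XYX; rewrite -!ampliationM XYX ampliationZ. Qed.
End Ampliation.

(** Tensoring with a 1 x 1 identity only re-indexes the matrix, so the map is a composite of three
    casts, each of which can be cancelled. *)
Lemma ampliation11_inj (F : fieldType) m N (e : (1 * m * 1 = N)%N) :
  injective (@ampliation F 1 1 m N e).
Proof.
move=> X Y; rewrite /ampliation => /(can_inj (castmxK _ _)).
rewrite !tens_mx_scalar !scale1r => /(can_inj (castmxK _ _)).
by rewrite !tens_scalar1mx => /(can_inj (castmxK _ _)).
Qed.

Lemma ampliation11_tl (F : fieldType) m N (e : (1 * m * 1 = N)%N) (c : F) X Y :
  ampliation e X *m ampliation e Y *m ampliation e X = c *: ampliation e X ->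
  X *m Y *m X = c *: X.
Proof. by rewrite -!ampliationM -ampliationZ => /ampliation11_inj. Qed.

Section LocalTemperleyLieb.
Variables (F : fieldType) (d : nat) (c : F).

Lemma local_copyZ n (x : F) (A : 'M[F]_(d * d)) (i : 'I_n.-1) :
  local_copy (x *: A) i = x *: local_copy A i.
Proof. by rewrite -[x *: A]addr0 local_copy_is_linear local_copy0 addr0. Qed.

(** Makes all the p_i local copies of one matrix on V (x) V, so that [local_copy_tl] applies to
    them. *)
Lemma local_copy_idempotent n (R : 'M[F]_(d * d)) q (i : 'I_n.-1) :
  local_copy ((q + 1)^-1 *: (q%:M - R)) i = local_idempotent R q i.
Proof. by rewrite local_copyZ local_copyB local_copy_scalar. Qed.

Lemma local_copy_tl (P : 'M[F]_(d * d)) :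
  let P1 := local_copy P (ord0 : 'I_3.-1) in
  let P2 := local_copy P (ord_max : 'I_3.-1) in
  P1 *m P2 *m P1 = c *: P1 -> P2 *m P1 *m P2 = c *: P2 ->
  forall n (i j : 'I_n.-1), `|i - j|%N = 1%N ->
  local_copy P i *m local_copy P j *m local_copy P i = c *: local_copy P i.
Proof.
have [//|e3 [E1 E2]] := @local_copy_adjacent F d 3 ord0 ord_max P.
move=> P1 P2; rewrite {}/P1 {}/P2 {}E1 {}E2.
(* Both outer dimensions, [d ^ 0] and [d ^ (3 - 0 - 3)], compute to 1, so the hypotheses descend to
   P (x) I and I (x) P. *)
move=> /(@ampliation11_tl _ _ _ e3) tl12 /(@ampliation11_tl _ _ _ e3) tl21.
move=> n i j dij; have [ij|ji] : i.+1 = j :> nat \/ j.+1 = i :> nat by lia.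
  have [e [-> ->]] := local_copy_adjacent P ij.
  exact: (ampliation_tl e tl12).
(* Now i is the right-hand neighbour, so the second relation is the one to transport. *)
have [e [-> ->]] := local_copy_adjacent P ji.
exact: (ampliation_tl e tl21).
Qed.

(** Identifies rho_n killing a relator with the relation among the p_i; it is used both to leave and
    to reach the factorization. *)
Lemma hecke_rep_tl (R : 'M[F]_(d * d)) (q : F) (ybR : yang_baxter R)
    (quadR : (R + 1%:M) *m (R - q%:M) = 0) n (i j : 'I_n.-1) :
  let p := @local_idempotent F d n R q in
  hecke_rep ybR quadR n
    (hecke_e q i * hecke_e q j * hecke_e q i - c *: hecke_e q i) =
  p i *m p j *m p i - c *: p i.
Proof.
have rep_e k : hecke_rep ybR quadR n (hecke_e q k) = local_idempotent R q k.
  by rewrite lrmorph_idempotent hecke_rep_gen.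
by apply: etrans (lrmorph_tl (hecke_rep ybR quadR n) _ _ _) _; rewrite !rep_e.
Qed.
End LocalTemperleyLieb.

Theorem proposition11p1 (K : realType) (d : nat) (R : 'M[K[i]]_(d * d))
    (q : K[i])
    (unitaryR : R \is unitarymx)
    (ybR : yang_baxter R)
    (spectrumR : exists a b : K[i],
       a != b /\ forall c, eigenvalue R c = (c == a) || (c == b))
    (quadR : (R + 1%:M) *m (R - q%:M) = 0)
    (qN1 : q != -1) :
  [<-> forall n, (2 <= n)%N ->
         exists f : {lrmorphism temperley_lieb n q -> 'M[K[i]]_(d ^ n)},
         forall x, hecke_rep ybR quadR n x = f (tl_proj n q x);
       let p1 : 'M_(d ^ 3) := local_idempotent R q (ord0 : 'I_3.-1) in
       let p2 : 'M_(d ^ 3) := local_idempotent R q (ord_max : 'I_3.-1) in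
       p1 *m p2 *m p1 = (q / (1 + q) ^+ 2) *: p1 /\
       p2 *m p1 *m p2 = (q / (1 + q) ^+ 2) *: p2;
       forall n (i j : 'I_n.-1), (3 <= n)%N -> `|i - j|%N = 1%N ->
         local_idempotent R q i *m local_idempotent R q j
           *m local_idempotent R q i
         = (q / (1 + q) ^+ 2) *: local_idempotent R q i ].
Proof.
tfae.
- move=> factor p1 p2; have [//|f repE] := factor 3.
  have tl (i j : 'I_3.-1) : `|i - j|%N = 1%N ->
      local_idempotent R q i *m local_idempotent R q j
        *m local_idempotent R q i
      = (q / (1 + q) ^+ 2) *: local_idempotent R q i.
    (* The defect of the relation is the image under [f] of a relator, which is already zero in the
       quotient. *)
    move=> ij; apply/eqP; rewrite -subr_eq0 -(hecke_rep_tl _ ybR quadR) repE.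
    have rel0 := @quot_proj_relator _ _ (tl_relators 3 q) _ (TLRelator q ij).
    by rewrite [tl_proj 3 q _]rel0 raddf0.
  by split; apply: tl.
- move=> [tl12 tl21] n i j _ ij.
  rewrite -!local_copy_idempotent; apply: local_copy_tl => //;
    rewrite !local_copy_idempotent; [exact: tl12 | exact: tl21].
- move=> tl n _.
  have rep0 x : tl_relators n q x -> hecke_rep ybR quadR n x = 0.
    case=> i j ij; rewrite hecke_rep_tl tl ?subrr //.
    (* Two adjacent indices below [n.-1] force [3 <= n]; for n = 2 there are no relators. *)
    by have := ltn_ord i; have := ltn_ord j; lia.
  exists (quot_lift rep0) => x.
  by rewrite [RHS]quot_liftE.
Qed.
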